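(* Let $n\geq 2$, $w>0$ and let $q_1\in C^2([0,\infty))$ be strictly monotone increasing with $g=q_1^{-1}$. Let $q_1$ satisfy $q_1(0)=0$ and $q_1'>0$ on $[g(c_1),w]$, where $c_1=\frac{c_2E_m}{E_M}$ and $c_2=q_1(w)$. Let $W:\mathbb{R}_+\times\mathbb{R}\to\mathbb{R}$ be a separable weighting of the form $W(E,t)=W_1(E)W_2(t)$, where $W_1\in C^1(\mathbb{R}_+)$ and $W_2\in C^1(\mathbb{R})$ are non-vanishing. Further let $W_2$ be bounded and have bounded first order derivative on $[-w,w]$. Then the generalized Bragg transform $\mathfrak{B}_n$ is injective on $L^2_0(\mathfrak{E}\times\mathbb{R}^n)$.
   Context: Notation: $\mathbb{R}_+=(0,\infty)$, and $\mathfrak{E}=[E_m,E_M]$ with $0<E_m<E_M$ fixed. $L^2_0(\Omega)$ is the set of (real-valued) $L^2$ functions with compact support on $\Omega$; $f\in L^2_0(\mathfrak{E}\times\mathbb{R}^n)$ is extended by zero to values of its first variable $q$ outside $\mathfrak{E}$. ''Non-vanishing'' means nowhere zero. For a constant $w>0$ let $B^n_w(\mathbf{s})=\{\mathbf{x}\in\mathbb{R}^n:|\mathbf{x}-\mathbf{s}|\le w\}$ and let $\chi_{B^n_w(\mathbf{s})}$ be its characteristic function. The generalized Bragg transform (with curve $q_1$, weighting $W$ and width $w$), regarded as a linear map $\mathfrak{B}_n:L^2_0(\mathfrak{E}\times\mathbb{R}^n)\to L^2(\mathbb{R}_+\times\mathbb{R}^n)$, is $$\mathfrak{B}_nf(E,\mathbf{s})=\int_{\mathbb{R}^n}W(E,|\mathbf{x}-\mathbf{s}|)\,\chi_{B^n_w(\mathbf{s})}(\mathbf{x})\,f(Eq_1(|\mathbf{x}-\mathbf{s}|),\mathbf{x})\,\mathrm{d}\mathbf{x},\qquad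 E\in\mathbb{R}_+,\ \mathbf{s}\in\mathbb{R}^n.$$ Injectivity means: if $\mathfrak{B}_nf=0$ almost everywhere then $f=0$ almost everywhere. *)

(* Defs.v *)
From HB Require Import structures.
From mathcomp Require Import all_boot all_order all_algebra.
From mathcomp Require Import all_classical all_reals all_analysis.

Set Implicit Arguments.
Unset Strict Implicit.
Unset Printing Implicit Defensive.
Import Order.TTheory GRing.Theory Num.Theory.
Import numFieldNormedType.Exports.
Local Open Scope classical_set_scope.
Local Open Scope ring_scope.

Definition rV_display : Type -> measure_display.
Proof. exact. Qed.

(* 'rV[R]_n carries the sigma-algebra generated by its coordinate maps, like
   n.-tuple R in the library; this is the Borel sigma-algebra of R^n. *)
Section measurable_rV.
Context {R : realType} (n : nat).

Definition rV_coord (i : 'I_n) (x : 'rV[R]_n) : measurableTypeR R := x ord0 i.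

Let rV_set0 : g_sigma_preimage rV_coord set0.
Proof. exact: sigma_algebra0. Qed.

Let rV_setC A : g_sigma_preimage rV_coord A -> g_sigma_preimage rV_coord (~` A).
Proof. exact: sigma_algebraC. Qed.

Let rV_bigcup (F : _^nat) : (forall i, g_sigma_preimage rV_coord (F i)) ->
  g_sigma_preimage rV_coord (\bigcup_i (F i)).
Proof. exact: sigma_algebra_bigcup. Qed.

HB.instance Definition _ := @isMeasurable.Build (rV_display R)
  'rV[R]_n (g_sigma_preimage rV_coord) rV_set0 rV_setC rV_bigcup.

Lemma measurable_rV_coord i : measurable_fun setT (rV_coord i).
Proof.
move=> _ Y mY; rewrite setTI; apply: sub_sigma_algebra => /=.
rewrite -bigcup_seq/=; exists i => /=; first by rewrite mem_index_enum.
by exists Y => //; rewrite setTI.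
Qed.

Lemma measurable_fun_rVP d (T : measurableType d) (f : T -> 'rV[R]_n) :
  (forall i, measurable_fun setT (rV_coord i \o f)) -> measurable_fun setT f.
Proof.
move=> mf _ A; rewrite setTI.
apply: (@smallest_sub _ _ _ [set B | measurable (f @^-1` B)]).
- split=> /=; first by rewrite preimage_set0.
  + by move=> B mB; rewrite setTD preimage_setC; exact: measurableC.
  + by move=> F mF; rewrite preimage_bigcup; exact: bigcupT_measurable.
- rewrite -bigcup_seq => B [i _ [C mC <-]] /=.
  by rewrite setTI -comp_preimage -[X in measurable X]setTI; exact: mf.
Qed.

End measurable_rV.

Section lebesgue_rV.
Context {R : realType}.

Definition rV_cons n (p : measurableTypeR R * 'rV[R]_n) : 'rV[R]_n.+1 :=
  \row_i (if unlift ord0 i is Some j then p.2 ord0 j else p.1).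

Lemma measurable_rV_cons n : measurable_fun setT (@rV_cons n).
Proof.
apply: measurable_fun_rVP => i; case: (unliftP ord0 i) => [j ->|->].
- rewrite (_ : _ \o _ = rV_coord j \o snd); last first.
    by apply/funext => p /=; rewrite /rV_coord mxE liftK.
  by apply: measurableT_comp => //; exact: measurable_rV_coord.
- rewrite (_ : _ \o _ = fst) //.
  by apply/funext => p /=; rewrite /rV_coord mxE unlift_none.
Qed.

Let measurable_preimage_rV_cons n (A : set 'rV[R]_n.+1) :
  measurable A -> measurable (@rV_cons n @^-1` A).
Proof. by move=> mA; rewrite -[X in measurable X]setTI; exact: measurable_rV_cons. Qed.

Section step.
Variables (n : nat) (mu : {sigma_finite_measure set 'rV[R]_n -> \bar R}).

Definition lebesgue_rV_step : set 'rV[R]_n.+1 -> \bar R :=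
  pushforward (lebesgue_measure \x mu)%E (@rV_cons n).

Let step0 : lebesgue_rV_step set0 = 0%E.
Proof. by rewrite /lebesgue_rV_step /pushforward preimage_set0 measure0. Qed.

Let step_ge0 A : (0 <= lebesgue_rV_step A)%E.
Proof. by rewrite /lebesgue_rV_step /pushforward; exact: measure_ge0. Qed.

Let step_sigma_additive : semi_sigma_additive lebesgue_rV_step.
Proof.
move=> F mF tF mUF; rewrite /lebesgue_rV_step /pushforward preimage_bigcup.
apply: measure_semi_sigma_additive.
- by move=> k; exact: measurable_preimage_rV_cons.
- apply/trivIsetP => /= i j _ _ ij; rewrite -preimage_setI.
  by move/trivIsetP : tF => /(_ _ _ _ _ ij) ->//; rewrite preimage_set0.
- by rewrite -preimage_bigcup; exact: measurable_preimage_rV_cons.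
Qed.

HB.instance Definition _ := isMeasure.Build _ _ _ lebesgue_rV_step
  step0 step_ge0 step_sigma_additive.

Let step_sigma_finite : sigma_finite setT lebesgue_rV_step.
Proof.
have /sigma_finiteP[F [TF ndF Foo]] := sigma_finiteT (@lebesgue_measure R).
have /sigma_finiteP[G [TG ndG Goo]] := sigma_finiteT mu.
pose uncons (x : 'rV[R]_n.+1) : measurableTypeR R * 'rV[R]_n :=
  (rV_coord ord0 x, \row_j x ord0 (lift ord0 j)).
have consK : cancel (@rV_cons n) uncons.
  move=> [t x]; rewrite /uncons /rV_coord !mxE unlift_none; congr pair.
  by apply/rowP => j; rewrite !mxE liftK.
have muncons : measurable_fun setT uncons.
  apply/measurable_fun_pair; first exact: measurable_rV_coord.
  apply: measurable_fun_rVP => j.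
  rewrite (_ : _ \o _ = rV_coord (lift ord0 j)); first exact: measurable_rV_coord.
  by apply/funext => x /=; rewrite /rV_coord mxE.
exists (fun k => uncons @^-1` (F k `*` G k)).
  rewrite -preimage_bigcup (_ : \bigcup_k _ = setT) ?preimage_setT//.
  apply/seteqP; split=> // -[t x] _.
  have [k _ Fkt] : (\bigcup_k F k) t by rewrite -TF.
  have [l _ Glx] : (\bigcup_k G k) x by rewrite -TG.
  exists (maxn k l) => //; split=> /=.
  - by move: t Fkt; exact/subsetPset/ndF/leq_maxl.
  - by move: x Glx; exact/subsetPset/ndG/leq_maxr.
move=> k; have [mF Fk] := Foo k; have [mG Gk] := Goo k; split.
  by rewrite -[X in measurable X]setTI; apply: muncons => //; exact: measurableX.
rewrite /lebesgue_rV_step /pushforward -comp_preimage.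
rewrite (_ : _ \o _ = idfun); last by apply/funext => p /=; rewrite consK.
by rewrite preimage_id product_measure1E// lte_mul_pinfty// ge0_fin_numE.
Qed.

HB.instance Definition _ := Measure_isSigmaFinite.Build _ _ _ lebesgue_rV_step
  step_sigma_finite.

End step.

Fixpoint lebesgue_rV (n : nat) : {sigma_finite_measure set 'rV[R]_n -> \bar R} :=
  if n is n'.+1 then lebesgue_rV_step (lebesgue_rV n') else dirac (0 : 'rV[R]_0).

Lemma lebesgue_rV_box n (A : 'I_n -> set (measurableTypeR R)) :
  (forall i, measurable (A i)) ->
  lebesgue_rV n [set x | forall i, A i (x ord0 i)] =
  (\prod_(i < n) lebesgue_measure (A i))%E.
Proof.
elim: n A => [|n IHn] A mA /=.
  by rewrite big_ord0 diracE mem_set// => -[].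
pose B := [set x : 'rV[R]_n | forall j, A (lift ord0 j) (x ord0 j)].
have mB : measurable B.
  rewrite (_ : B = \bigcap_(j in [set: 'I_n]) (rV_coord j @^-1` A (lift ord0 j))).
    apply: fin_bigcap_measurable => // j _.
    by rewrite -[X in measurable X]setTI; exact: measurable_rV_coord.
  by apply/seteqP; split=> x Bx j => [_|]; exact: Bx.
rewrite big_ord_recl -IHn// -/B /lebesgue_rV_step /pushforward.
rewrite -product_measure1E//; congr (_ _).
apply/seteqP; split=> -[t x] /=.
  move=> H; split=> [|j]; first by have := H ord0; rewrite mxE unlift_none.
  by have := H (lift ord0 j); rewrite mxE liftK.
by move=> [At Bx] i; rewrite mxE; case: (unliftP ord0 i) => [j ->|->] //.
Qed.

End lebesgue_rV.

(* One-sided at those points of D that are not interior to D. *)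
Definition is_derive_on {R : realType} (D : set R) (f : R -> R) (x df : R) :=
  (fun y => (f y - f x) / (y - x)) @ within D (dnbhs x) --> df.

Fixpoint Ck_on {R : realType} (k : nat) (D : set R) (f : R -> R) : Prop :=
  {within D, continuous f} /\
  if k is k'.+1 then
    exists2 f' : R -> R, (forall x, D x -> is_derive_on D f x (f' x)) &
      Ck_on k' D f'
  else True.

(* The norm of the library on 'rV[R]_n is the sup norm. *)
Definition enorm {R : realType} {n : nat} (x : 'rV[R]_n) : R :=
  Num.sqrt (\sum_(i < n) x ord0 i ^+ 2).

Definition closed_eball {R : realType} {n : nat} (s : 'rV[R]_n) (w : R) :
  set 'rV[R]_n := [set x | enorm (x - s) <= w].

Section bragg.
Context {R : realType} {n : nat}.

(* An element of L^2(Omega) is represented by a function on the whole space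
   R x R^n vanishing almost everywhere outside Omega. *)
Definition L2_0 (Omega : set (R * 'rV[R]_n)) :
  set (measurableTypeR R * 'rV[R]_n -> R) :=
  [set f | f \in Lfun (lebesgue_measure \x lebesgue_rV n)%E 2%:E /\
    exists2 K : set (R * 'rV[R]_n), compact K /\ K `<=` Omega &
      {ae (lebesgue_measure \x lebesgue_rV n)%E,
        forall p, ~ K p -> f p = 0}].

Definition bragg (W : R -> R -> R) (q1 : R -> R) (w : R)
    (f : measurableTypeR R * 'rV[R]_n -> R) (E : R) (s : 'rV[R]_n) : R :=
  \int[lebesgue_rV n]_x
    (W E (enorm (x - s)) * \1_(closed_eball s w) x *
     f (E * q1 (enorm (x - s)), x)).

End bragg.

(* Main.v *)
(** Let [theta(E, s) = E^-k exp(l . s)], a real character of the group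
    R_+ x R^n. Up to the nonvanishing factor [W1 E], the Bragg transform is a
    convolution on this group, with the measure of density [W2 |y|] on the ball
    of radius [w], carried by the graph of [y |-> 1 / q1 |y|]. Integrating it
    against [theta] and the Haar measure [dE / E * ds] therefore gives the
    product of the moment of [f] at [theta] with
    [\int W2 |y| q1 |y|^k exp(- l . y) dy] over the ball. The latter integral
    converges for every natural number [k], because [q1] is bounded on the ball,
    and is nonzero, because [W2] has constant sign. Hence all the moments
    [\int\int f(q, x) q^-k exp(l . x) dx dq / q] vanish. As [f] vanishes outside
    a compact subset of R_+ x R^n, where the characters are bounded, separate
    points and are stable under multiplication, [f] is zero.

    The positive and negative parts of [f] are integrated separately, so that only
    Tonelli's theorem is needed. *)

Require Import Defs.
From mathcomp Require Import all_boot all_order all_algebra.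
From mathcomp Require Import all_classical all_reals all_analysis.
From mathcomp Require Import measurable_realfun lra ring.
Import Order.TTheory GRing.Theory Num.Theory.
Import numFieldNormedType.Exports.
Local Open Scope classical_set_scope.
Local Open Scope ring_scope.

Section step_polynomial.
Context {R : realType}.

Lemma bernoulli_ineq (x : R) (n : nat) : -1 <= x -> 1 + n%:R * x <= (1 + x) ^+ n.
Proof.
move=> x1; elim: n => [|n IH]; first by rewrite mul0r addr0 expr0.
have x0 : 0 <= 1 + x by lra.
rewrite exprS; apply: le_trans (ler_wpM2l x0 IH).
rewrite -natr1; have : 0 <= n%:R * x ^+ 2 by rewrite mulr_ge0 ?sqr_ge0.
by rewrite expr2; nra.
Qed.

Lemma expr1B_le_inv (a : R) (n : nat) : 0 <= a <= 1 ->
  (1 - a) ^+ n <= (1 + n%:R * a)^-1.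
Proof.
move=> /andP[a0 a1].
have na : 0 <= n%:R * a by rewrite mulr_ge0.
have h1 : 0 <= (1 - a) ^+ n by rewrite exprn_ge0//; lra.
rewrite -[leRHS]mul1r ler_pdivlMr; last by lra.
apply: (@le_trans _ _ ((1 - a) ^+ n * (1 + a) ^+ n)).
  by apply: ler_wpM2l => //; apply: bernoulli_ineq; lra.
by rewrite -exprMn exprn_ile1//; nra.
Qed.

Lemma cvg_natr_expr0 (z : R) : 0 <= z < 1 ->
  (fun n => n%:R * z ^+ n) @ \oo --> (0 : R).
Proof.
move=> /andP[z0 z1].
have [->|zn0] := eqVneq z 0.
  apply: cvg_near_cst; near=> n.
  by rewrite expr0n gtn_eqF ?mulr0//; near: n; exact: nbhs_infty_gt.
have zp : 0 < z by rewrite lt_neqAle eq_sym zn0.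
pose y := Num.sqrt z.
have y0 : 0 < y by rewrite sqrtr_gt0.
have y1 : y < 1 by rewrite -sqrtr1 ltr_sqrt.
pose h := y^-1 - 1.
have h0 : 0 < h by rewrite subr_gt0 invf_gt1.
have yh : y = (1 + h)^-1 by rewrite /h addrC subrK invrK.
apply: (@squeeze_cvgr _ _ _ _ (cst 0) (fun n => h^-1 * y ^+ n)).
- apply: nearW => n /=; rewrite mulr_ge0 ?exprn_ge0//=.
  rewrite -(sqr_sqrtr z0) -/y -exprM mulnC exprM -[_ ^+ 2]/(_ * _) mulrA.
  apply: ler_wpM2r; first by rewrite exprn_ge0// ltW.
  rewrite {1}yh exprVn ler_pdivrMr ?exprn_gt0//; last by lra.
  rewrite mulrC ler_pdivlMr//.
  by apply: le_trans (@bernoulli_ineq h n _); lra.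
- exact: cvg_cst.
- rewrite -[X in _ --> X](mulr0 h^-1); apply: cvgMr.
  by apply: cvg_expr; rewrite ger0_norm// ltW.
Unshelve. all: end_near. Qed.

Definition step_poly (m : nat) (t : R) := (1 - t ^+ m) ^+ (m * 2 ^ m)%N.

Lemma step_poly_itv m t : 0 <= t <= 1 -> 0 <= step_poly m t <= 1.
Proof.
move=> /andP[t0 t1]; have tm0 : 0 <= t ^+ m by rewrite exprn_ge0.
have tm1 : t ^+ m <= 1 by rewrite exprn_ile1.
by rewrite /step_poly exprn_ge0 ?exprn_ile1//; lra.
Qed.

(* The extra factor [m] in the exponent of [step_poly] makes the limit [0],
   rather than [1 / e], at the threshold [t = 1 / 2]. *)
Lemma step_poly_cvg (t : R) : 0 <= t <= 1 ->
  step_poly ^~ t @ \oo --> ((t < 2^-1)%R%:R : R).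
Proof.
move=> /andP[t0 t1].
have tm m : 0 <= t ^+ m <= 1 by rewrite exprn_ge0//= exprn_ile1.
have tE m : (m * 2 ^ m)%:R * t ^+ m = m%:R * (2 * t) ^+ m.
  by rewrite natrM natrX exprMn mulrA.
have v01 m := step_poly_itv m t.
have [th|th] := ltP t 2^-1.
- apply: (@squeeze_cvgr _ _ _ _ (fun m => 1 - m%:R * (2 * t) ^+ m) (cst 1)).
  + apply: nearW => m /=; have /andP[_ ->] := v01 m (introT andP (conj t0 t1)).
    rewrite andbT -tE -mulrN; have /andP[? ?] := tm m.
    by apply: bernoulli_ineq; lra.
  + rewrite -[X in _ --> X]subr0; apply: cvgB; first exact: cvg_cst.
    by apply: cvg_natr_expr0; lra.
  + exact: cvg_cst.
- apply: (@squeeze_cvgr _ _ _ _ (cst 0) harmonic).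
  + apply: nearW => m /=; have /andP[-> _] := v01 m (introT andP (conj t0 t1)).
    apply: (le_trans (expr1B_le_inv _ _ (tm m))).
    rewrite tE /harmonic/= lef_pV2 ?posrE//; last first.
      by rewrite ltr_pwDl// mulr_ge0// exprn_ge0// mulr_ge0.
    rewrite -nat1r lerD2l ler_peMr// exprn_ege1//; lra.
  + exact: cvg_cst.
  + exact: cvg_harmonic.
Qed.

End step_polynomial.

(* The indicator functions in the class [multiplier] below form a sigma-algebra:
   multipliers are stable under linear combinations, products and bounded
   pointwise limits. By [step_poly], it contains the sublevel sets of the
   functions in [S]. *)
Section multiplier.
Context d (T : measurableType d) (R : realType) (mu : {measure set T -> \bar R}).
Variables (D : set T) (mD : measurable D) (F : T -> R).
Hypothesis iF : mu.-integrable D (EFin \o F).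

Definition bounded_mfun (g : T -> R) :=
  measurable_fun D g /\ exists C, forall x, D x -> `|g x| <= C.

Lemma bounded_mfunM g h :
  bounded_mfun g -> bounded_mfun h -> bounded_mfun (g \* h).
Proof.
move=> [mg [C gC]] [mh [C' hC']]; split; first exact: measurable_funM.
by exists (C * C') => x Dx; rewrite normrM ler_pM// ?gC ?hC'.
Qed.

Lemma bounded_mfun_lin a b g h : bounded_mfun g -> bounded_mfun h ->
  bounded_mfun (fun x => a * g x + b * h x).
Proof.
move=> [mg [C gC]] [mh [C' hC']]; split.
  by apply: measurable_funD; apply: measurable_funM.
exists (`|a| * C + `|b| * C') => x Dx; apply: (le_trans (ler_normD _ _)).
by rewrite !normrM lerD// ler_wpM2l// ?gC ?hC'.
Qed.

Lemma integrable_bounded_mfun g : bounded_mfun g ->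
  mu.-integrable D (fun x => (F x * g x)%:E).
Proof.
move=> [mg [C gC]]; apply: (integrableMl mD iF mg).
exists C; split; first by rewrite num_real.
by move=> y Cy x Dx; apply: le_trans (gC x Dx) (ltW Cy).
Qed.

Variable S : set (T -> R).
Hypothesis bS : forall chi, S chi -> bounded_mfun chi.
Hypothesis S1 : S (cst 1).
Hypothesis SM : forall chi chi', S chi -> S chi' -> S (chi \* chi').
Hypothesis S0 : forall chi, S chi -> (\int[mu]_(x in D) (F x * chi x)%:E = 0)%E.

Definition annihilated (psi : T -> R) := bounded_mfun psi /\
  forall chi, S chi -> (\int[mu]_(x in D) (F x * (psi x * chi x))%:E = 0)%E.

Definition multiplier (phi : T -> R) := bounded_mfun phi /\
  forall psi, annihilated psi -> annihilated (phi \* psi).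

Lemma multiplier_char chi : S chi -> multiplier chi.
Proof.
move=> Schi; split=> [|psi [bpsi psi0]]; first exact: bS.
split=> [|chi' Schi']; first by apply: bounded_mfunM => //; exact: bS.
rewrite -(psi0 _ (SM _ _ Schi Schi')); apply: eq_integral => x _ /=.
by congr EFin; ring.
Qed.

Lemma multiplierM phi phi' :
  multiplier phi -> multiplier phi' -> multiplier (phi \* phi').
Proof.
move=> [bphi mphi] [bphi' mphi']; split=> [|psi /mphi' /mphi].
  exact: bounded_mfunM.
by congr annihilated; apply/funext => x /=; rewrite mulrA.
Qed.

Lemma multiplier_lin a b phi phi' : multiplier phi -> multiplier phi' ->
  multiplier (fun x => a * phi x + b * phi' x).
Proof.
move=> [bphi mphi] [bphi' mphi']; split=> [|psi apsi].
  exact: bounded_mfun_lin.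
have [b1 i1] := mphi _ apsi; have [b2 i2] := mphi' _ apsi.
split=> [|chi Schi].
  by apply: bounded_mfunM; [exact: bounded_mfun_lin|case: apsi].
transitivity (\int[mu]_(x in D) (a%:E * (F x * ((phi \* psi) x * chi x))%:E
    + b%:E * (F x * ((phi' \* psi) x * chi x))%:E))%E.
  by apply: eq_integral => x _; rewrite -!EFinM -EFinD; congr EFin => /=; ring.
have i1' : mu.-integrable D (fun x => (F x * ((phi \* psi) x * chi x))%:E).
  by apply: (integrable_bounded_mfun (_ \* chi)); apply: bounded_mfunM => //; exact: bS.
have i2' : mu.-integrable D (fun x => (F x * ((phi' \* psi) x * chi x))%:E).
  by apply: (integrable_bounded_mfun (_ \* chi)); apply: bounded_mfunM => //; exact: bS.
rewrite integralD//; [|exact: integrableZl|exact: integrableZl].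
by rewrite !integralZl// i1// i2// !mule0 adde0.
Qed.

Lemma multiplier_cst c : multiplier (cst c).
Proof.
have := multiplier_lin c 0 _ _ (multiplier_char _ S1) (multiplier_char _ S1).
by congr multiplier; apply/funext => x /=; ring.
Qed.

Lemma multiplierX phi k : multiplier phi -> multiplier (fun x => phi x ^+ k).
Proof.
move=> mphi; elim: k => [|k IH]; first exact: multiplier_cst.
have := multiplierM _ _ mphi IH.
by congr multiplier; apply/funext => x /=; rewrite exprS.
Qed.

Lemma multiplier_cvg (phi_ : nat -> T -> R) (phi : T -> R) (C : R) :
  (forall k, multiplier (phi_ k)) ->
  (forall k x, D x -> `|phi_ k x| <= C) ->
  (forall x, D x -> phi_ ^~ x @ \oo --> phi x) -> multiplier phi.
Proof.
move=> mphi_ phiC cphi.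
have mphi : measurable_fun D phi.
  by apply: (@measurable_fun_cvg _ _ _ _ phi_) => // k; have [[]] := mphi_ k.
have bphi : bounded_mfun phi.
  split => //; exists C => x Dx.
  have cn : (fun k => `|phi_ k x|) @ \oo --> `|phi x|.
    by apply: cvg_norm; exact: cphi.
  rewrite -(cvg_lim (@Rhausdorff R) cn).
  apply: limr_le; first by apply/cvg_ex; eexists; exact: cn.
  by apply: nearW => k; exact: phiC.
split=> // psi apsi; have [bpsi ipsi] := apsi.
split=> [|chi Schi]; first exact: bounded_mfunM.
have bpc : bounded_mfun (psi \* chi) by apply: bounded_mfunM => //; exact: bS.
have /integrable_norm iabs := integrable_bounded_mfun _ bpc.
have [|||||_ _] := @dominated_convergence _ _ _ mu D mD
  (fun k x => (F x * ((phi_ k x * psi x) * chi x))%:E)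
  (fun x => (F x * ((phi x * psi x) * chi x))%:E)
  (fun x => C%:E * `|F x * (psi x * chi x)|%:E)%E.
- move=> k; have [bk _] := mphi_ k.
  apply: measurable_int (integrable_bounded_mfun ((phi_ k \* psi) \* chi) _).
  by apply: bounded_mfunM; [exact: bounded_mfunM|exact: bS].
- apply: measurable_int (integrable_bounded_mfun ((phi \* psi) \* chi) _).
  by apply: bounded_mfunM; [exact: bounded_mfunM|exact: bS].
- apply: aeW => x Dx; apply/fine_cvgP; split; first exact: nearW.
  rewrite /comp/=; apply: cvgMr; apply: cvgMl; apply: cvgMl; exact: cphi.
- by apply: integrableZl.
- apply: aeW => x k Dx; rewrite abse_EFin -EFinM lee_fin.
  have -> : F x * (phi_ k x * psi x * chi x) = phi_ k x * (F x * (psi x * chi x)).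
    by ring.
  by rewrite normrM ler_wpM2r// phiC.
move=> cv; rewrite -(cvg_lim _ cv)//.
apply/cvg_lim => //; apply: cvg_near_cst; apply: nearW => k.
by have [_ /(_ _ apsi)[_ /(_ _ Schi)]] := mphi_ k.
Qed.

Lemma eq_multiplier phi phi' : {in D, phi =1 phi'} ->
  multiplier phi -> multiplier phi'.
Proof.
move=> phiE mphi; have [[_ [C phiC]] _] := mphi.
apply: (multiplier_cvg (fun=> phi) _ C) => // x Dx.
by rewrite phiE ?inE//; exact: cvg_cst.
Qed.

Lemma multiplier_indicC A : multiplier \1_A -> multiplier \1_(~` A).
Proof.
move=> mA; have := multiplier_lin 1 (-1) _ _ (multiplier_cst 1) mA.
congr multiplier; apply/funext => x /=; rewrite !indicE in_setC.
by case: (_ \in _) => /=; ring.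
Qed.

Lemma multiplier_indicI A B :
  multiplier \1_A -> multiplier \1_B -> multiplier \1_(A `&` B).
Proof. by move=> mA mB; rewrite indicI; exact: multiplierM. Qed.

Lemma multiplier_indic_bigcup (A : (set T)^nat) :
  (forall k, multiplier \1_(A k)) -> multiplier \1_(\bigcup_k A k).
Proof.
move=> mA; pose B k := \big[setU/set0]_(i < k) A i.
have mB k : multiplier \1_(B k).
  rewrite /B; elim: k => [|k IH].
    by rewrite big_ord0 indic0; exact: multiplier_cst.
  rewrite big_ord_recr/= -[_ `|` _]setCK setCU.
  by apply: multiplier_indicC; apply: multiplier_indicI; apply: multiplier_indicC.
apply: (multiplier_cvg (fun k => \1_(B k)) _ 1) => // [k x _|x _].
  by rewrite indicE; case: (_ \in _); rewrite ?normr0 ?normr1.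
apply: cvg_near_cst; have [[k _ Akx]|nAx] := pselect ((\bigcup_k A k) x).
  near=> m; rewrite !indicE !mem_set//; first by exists k.
  rewrite /B -bigcup_mkord; exists k => //=; near: m; exact: nbhs_infty_gt.
apply: nearW => m; rewrite !indicE !memNset// /B -bigcup_mkord => -[k _ Akx].
by apply: nAx; exists k.
Unshelve. all: end_near. Qed.

Lemma multiplier_indic_lt u c : S u -> multiplier \1_[set x | u x < c].
Proof.
move=> Su; have [mu_ [C uC]] := bS _ Su.
pose K := 2 * (`|C| + `|c| + 1).
have K0 : 0 < K by rewrite /K mulr_gt0//; have := normr_ge0 C; have := normr_ge0 c; lra.
pose l x := 2^-1 + K^-1 * (u x - c).
have l01 x : D x -> 0 <= l x <= 1.
  move=> /uC uxC; have uc : `|u x - c| <= 2^-1 * K.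
    rewrite /K mulKf//; apply: (le_trans (ler_normB _ _)).
    have := ler_norm C; lra.
  have : `|K^-1 * (u x - c)| <= 2^-1.
    by rewrite normrM gtr0_norm ?invr_gt0// mulrC ler_pdivrMr.
  by rewrite ler_norml /l; lra.
have lc x : (l x < 2^-1) = (u x < c).
  by rewrite /l gtrDl pmulr_rlt0 ?invr_gt0// subr_lt0.
apply: (multiplier_cvg (fun m x => step_poly m (l x)) _ 1) => [m|m x Dx|x Dx].
- apply: multiplierX.
  have ml : multiplier l.
    have := multiplier_lin 1 K^-1 _ _ (multiplier_cst (2^-1 - K^-1 * c)) (multiplier_char _ Su).
    by congr multiplier; apply/funext => x; rewrite /l/=; ring.
  have := multiplier_lin 1 (-1) _ _ (multiplier_cst 1) (multiplierX _ m ml).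
  by congr multiplier; apply/funext => x/=; ring.
- by have /andP[? ?] := step_poly_itv m _ (l01 _ Dx); rewrite ger0_norm.
- have := step_poly_cvg _ (l01 _ Dx); rewrite lc indicE.
  by rewrite (_ : x \in _ = (u x < c))//; apply/idP/idP; rewrite inE.
Qed.

Lemma multiplier_sigma_algebra :
  sigma_algebra setT [set A | multiplier \1_A].
Proof.
split=> [|A|A mA] /=.
- by rewrite indic0; exact: multiplier_cst.
- by rewrite setTD; exact: multiplier_indicC.
- exact: multiplier_indic_bigcup.
Qed.

Lemma multiplier_ae0 : (forall A, measurable A -> multiplier \1_A) ->
  {ae mu, forall x, D x -> F x = 0}.
Proof.
move=> mult.
have a1 : annihilated (cst 1).
  split; first by have [] := multiplier_cst 1.
  by move=> chi /S0 <-; apply: eq_integral => x _ /=; rewrite mul1r.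
have : ae_eq mu D (EFin \o F) (cst 0%E).
  apply: integral_ae_eq => // E ED mE.
  have [_ /(_ _ a1)[_ /(_ _ S1) E0]] := mult _ mE.
  rewrite integral0 -[RHS]E0 -{1}(setIidr ED) integral_mkcondr.
  apply: eq_integral => x xD; rewrite /patch /= indicE.
  by case: (x \in E); rewrite /= !(mulr1, mul0r, mulr0).
by apply: filterS => x /= h Dx; have [] := h Dx.
Qed.

End multiplier.

Section sigma_algebra_halfspaces.
Context {R : realType} {n : nat}.
Local Notation T := (measurableTypeR R * 'rV[R]_n)%type.

Lemma sigma_algebra_setI (aT : Type) (G : set (set aT)) (A B : set aT) :
  sigma_algebra setT G -> G A -> G B -> G (A `&` B).
Proof.
move=> [G0 GC GU] GA GB; have GC' X : G X -> G (~` X) by rewrite -setTD; exact: GC.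
rewrite -[_ `&` _]setCK setCI -bigcup2E; apply/GC'/GU => -[|[|k]]//=; exact: GC'.
Qed.

Lemma sigma_algebra_preimage_measurable (aT : Type) (G : set (set aT))
    (u : aT -> R) : sigma_algebra setT G ->
  (forall c, G [set x | c < u x]) ->
  forall A : set (measurableTypeR R), measurable A -> G (u @^-1` A).
Proof.
move=> sG Gu A mA0.
have mA : (@RGenOInfty.G R).-sigma.-measurable A by rewrite -RGenOInfty.measurableE.
suff : image_set_system setT u G A by rewrite /image_set_system/= setTI.
move: A {mA0} mA; apply: smallest_sub; first exact: sigma_algebra_image.
move=> _ [c ->]; rewrite /image_set_system/= setTI.
have := Gu c; congr G; apply/seteqP.
by split=> x /=; rewrite in_itv/= andbT.
Qed.

Lemma sigma_algebra_halfspaces (G : set (set T)) : sigma_algebra setT G ->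
  (forall c : R, G [set p : T | c < p.1]) ->
  (forall i (c : R), G [set p : T | c < p.2 ord0 i]) ->
  forall A : set T, measurable A -> G A.
Proof.
move=> sG G1 G2 A; rewrite measurable_prod_measurableType.
move: A; apply: smallest_sub => // _ [A mA [B mB <-]].
rewrite (_ : A `*` B = (fst @^-1` A) `&` (snd @^-1` B)); last first.
  by apply/seteqP; split.
apply: sigma_algebra_setI => //.
  exact: (sigma_algebra_preimage_measurable _ _ _ sG G1).
suff : image_set_system setT (snd : T -> 'rV[R]_n) G B.
  by rewrite /image_set_system/= setTI.
move: B mB; apply: smallest_sub; first exact: sigma_algebra_image.
rewrite -bigcup_seq => B [i _ [C mC <-]] /=.
rewrite /image_set_system/= !setTI -comp_preimage.
exact: (sigma_algebra_preimage_measurable _ _ _ sG (G2 i)).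
Qed.

End sigma_algebra_halfspaces.

Lemma measurable_inv (R : realType) : measurable_fun [set: R] (@GRing.inv R).
Proof.
have oN0 : open [set x : R | x != 0] by exact: open_neq.
rewrite (_ : [set: R] = [set x | x != 0] `|` [set 0]); last first.
  by apply/seteqP; split=> // x _ /=; have [|] := eqVneq x 0; [right|left].
apply/measurable_funU => //; first exact: open_measurable.
split; last exact: measurable_fun_set1.
by apply: open_continuous_measurable_fun => // x /[!inE]; exact: inv_continuous.
Qed.

Section characters.
Context {R : realType} {n : nat}.
Local Notation T := (measurableTypeR R * 'rV[R]_n)%type.
Local Notation mu := (lebesgue_measure \x @lebesgue_rV R n)%E.

Definition character (k : nat) (l : 'I_n -> R) (p : T) : R :=
  p.1^-1 ^+ k * expR (\sum_(i < n) l i * p.2 ord0 i).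

Definition cylinder (a b M : R) : set T :=
  [set p : T | a <= p.1 <= b /\ forall i, `|p.2 ord0 i| <= M].

Lemma measurable_fst_prodR : measurable_fun [set: T] (fun p : T => p.1 : R).
Proof. exact: measurable_fst. Qed.

Lemma measurable_snd_coord i : measurable_fun [set: T] (fun p : T => p.2 ord0 i : R).
Proof.
exact: (measurableT_comp (measurable_rV_coord i) measurable_snd).
Qed.

Lemma measurable_cylinder a b M : measurable (cylinder a b M).
Proof.
rewrite (_ : cylinder a b M = [set p : T | a <= p.1 <= b] `&`
    \bigcap_(i in [set: 'I_n]) [set p : T | `|p.2 ord0 i| <= M]).
  apply: measurableI.
    have := measurable_fst_prodR measurableT _ (measurable_itv `[a, b]).
    by rewrite setTI; congr measurable; apply/seteqP; split=> p /=; rewrite in_itv.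
  apply: fin_bigcap_measurable => // i _.
  have := measurable_snd_coord i measurableT _ (measurable_itv `[-M, M]).
  by rewrite setTI; congr measurable; apply/seteqP; split=> p /=;
    rewrite in_itv/= ler_norml.
by apply/seteqP; split=> p [p1 p2]; split=> // i; [move=> _|]; apply: p2.
Qed.

Lemma measurable_character k l : measurable_fun [set: T] (character k l).
Proof.
apply: measurable_funM.
  apply: measurable_funX; apply: measurableT_comp measurable_fst_prodR.
  exact: measurable_inv.
apply: measurableT_comp => //; apply: measurable_sum => i.
by apply: measurable_funM => //; exact: measurable_snd_coord.
Qed.

Lemma character_bounded a b M k l : 0 < a -> 0 <= M ->
  bounded_mfun _ _ _ (cylinder a b M) (character k l).
Proof.
move=> a0 M0; split; first by apply: measurable_funTS; exact: measurable_character.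
exists (a^-1 ^+ k * expR (\sum_(i < n) `|l i| * M)) => p [/andP[ap _] pM].
have p0 : 0 < p.1 by exact: lt_le_trans ap.
have pk0 : 0 <= p.1^-1 ^+ k by rewrite exprn_ge0 ?invr_ge0 ?ltW.
rewrite /character ger0_norm ?mulr_ge0 ?expR_ge0//.
apply: ler_pM => //; rewrite ?expR_ge0//.
  by apply: lerXn2r; rewrite ?nnegrE ?invr_ge0 ?lef_pV2 ?posrE// ltW.
rewrite ler_expR; apply: ler_sum => i _.
by apply: (le_trans (ler_norm _)); rewrite normrM ler_wpM2l.
Qed.

Lemma characterM k l k' l' p :
  character k l p * character k' l' p = character (k + k') (fun i => l i + l' i) p.
Proof.
rewrite /character mulrACA -exprD -expRD -big_split/=.
by congr (_ * expR _); apply: eq_bigr => i _; rewrite mulrDl.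
Qed.

(* The characters below are [1 / q] and [exp (- x_i)]: their sublevel sets are
   half-spaces. *)
Lemma character_moments_ae0 a b M (F : T -> R) : 0 < a -> 0 <= M ->
  mu.-integrable (cylinder a b M) (EFin \o F) ->
  (forall k l, \int[mu]_(p in cylinder a b M) (F p * character k l p)%:E = 0)%E ->
  {ae mu, forall p, cylinder a b M p -> F p = 0}.
Proof.
move=> a0 M0 iF F0; set D := cylinder a b M.
have mD : measurable D by exact: measurable_cylinder.
pose S := [set chi | exists k l, chi = character k l].
have c0E : character 0 (fun=> 0) = cst 1.
  apply/funext => p; rewrite /character expr0 mul1r big1 ?expR0// => i _.
  by rewrite mul0r.
have bS chi : S chi -> bounded_mfun _ _ _ D chi.
  by move=> [k [l ->]]; exact: character_bounded.
have S1 : S (cst 1) by exists 0%N, (fun=> 0); rewrite c0E.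
have SM chi chi' : S chi -> S chi' -> S (chi \* chi').
  move=> [k [l ->]] [k' [l' ->]]; exists (k + k')%N, (fun i => l i + l' i).
  by apply/funext => p; rewrite -characterM.
have S0 chi : S chi -> (\int[mu]_(p in D) (F p * chi p)%:E = 0)%E.
  by move=> [k [l ->]]; exact: F0.
have mlt := @multiplier_indic_lt _ _ _ mu D mD F iF S bS S1 SM.
have meq := @eq_multiplier _ _ _ mu D mD F iF S bS.
apply: (@multiplier_ae0 _ _ _ mu D mD F iF S bS S1 SM S0).
apply: sigma_algebra_halfspaces.
- exact: multiplier_sigma_algebra.
- move=> c; have [c0|c0] := leP c 0.
    apply: meq (@multiplier_cst _ _ _ mu D mD F iF S bS S1 SM 1).
    move=> p; rewrite inE => -[/andP[ap _] _]; rewrite indicE mem_set//=.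
    by apply: le_lt_trans c0 _; exact: lt_le_trans ap.
  have S1' : S (character 1 (fun=> 0)) by exists 1%N, (fun=> 0).
  apply: meq (mlt _ c^-1 S1') => p; rewrite inE => -[/andP[ap _] _].
  have p0 : 0 < p.1 by exact: lt_le_trans ap.
  rewrite !indicE; congr (nat_of_bool _)%:R; apply: asbool_equiv_eq => /=.
  rewrite /character expr1 big1 ?expR0 ?mulr1; last by move=> i _; rewrite mul0r.
  by rewrite ltf_pV2.
- move=> i c.
  have Si : S (character 0 (fun j => - (j == i)%:R)) by eexists; eexists.
  apply: meq (mlt _ (expR (- c)) Si) => p _.
  rewrite !indicE; congr (nat_of_bool _)%:R; apply: asbool_equiv_eq => /=.
  rewrite /character expr0 mul1r (bigD1 i)//= eqxx big1 ?addr0; last first.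
    by move=> j /negbTE ->; rewrite oppr0 mul0r.
  by rewrite ltr_expR mulN1r ltrN2.
Qed.

End characters.

Local Notation pushforward_measure :=
  measure_function_pushforward__canonical__measure_function_Measure.

Section lebesgue_affine.
Context {R : realType}.
Local Notation leb := (@lebesgue_measure R).

Lemma measurable_affine (a b : R) :
  measurable_fun [set: measurableTypeR R] (fun t => a * t + b : measurableTypeR R).
Proof. by apply: measurable_funD => //; exact: mulrl_measurable. Qed.

Lemma ge0_integral_affine (a b : R) (h : measurableTypeR R -> \bar R) : a != 0 ->
  measurable_fun setT h -> (forall x, 0 <= h x)%E ->
  (`|a|%:E * \int[leb]_t h (a * t + b)%R = \int[leb]_t h t)%E.
Proof.
move=> a0 mh h0.
pose phi (t : measurableTypeR R) : measurableTypeR R := a * t + b.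
have mphi : measurable_fun setT phi := measurable_affine a b.
pose k : {nonneg R} := NngNum (normr_ge0 a).
pose nu0 := pushforward_measure leb mphi.
pose nu : {measure set (measurableTypeR R) -> \bar R} := mscale k nu0.
have lebE A : measurable A -> leb A = nu A.
  apply: lebesgue_measure_unique => /= _ [[x y] _ <-].
  rewrite /nu/= /mscale/= /pushforward/=.
  have [a_gt0|a_lt0|/eqP] := ltgtP a 0; last by rewrite (negbTE a0).
  - rewrite (_ : _ @^-1` _ = `[(y - b) / a, (x - b) / a[%classic); last first.
      apply/seteqP; split=> t; rewrite /phi /= !in_itv/= ler_ndivrMr// ltr_ndivlMr//.
        by rewrite [t * a]mulrC; move=> /andP[? ?]; apply/andP; split; lra.
      by rewrite [t * a]mulrC; move=> /andP[? ?]; apply/andP; split; lra.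
    rewrite !lebesgue_measure_itv/= !lte_fin ltr_ndivlMr// mulfVK// ltrD2r.
    case: ifPn => _; rewrite ?mule0// ltr0_norm// -!EFinB -EFinM; congr EFin.
    by field.
  - rewrite (_ : _ @^-1` _ = `](x - b) / a, (y - b) / a]%classic); last first.
      apply/seteqP; split=> t; rewrite /phi /= !in_itv/= ltr_pdivrMr// ler_pdivlMr//.
        by rewrite [t * a]mulrC; move=> /andP[? ?]; apply/andP; split; lra.
      by rewrite [t * a]mulrC; move=> /andP[? ?]; apply/andP; split; lra.
    rewrite !lebesgue_measure_itv/= !lte_fin ltr_pdivrMr// mulfVK// ltrD2r.
    case: ifPn => _; rewrite ?mule0// gtr0_norm// -!EFinB -EFinM; congr EFin.
    by field.
rewrite [RHS](eq_measure_integral nu); last by move=> A mA _; exact: lebE.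
rewrite ge0_integral_mscale//; congr (_ * _)%E.
by rewrite ge0_integral_pushforward.
Qed.

End lebesgue_affine.

Section lebesgue_rV_theory.
Context {R : realType}.
Local Notation leb := (@lebesgue_measure R).

Lemma ge0_integral_lebesgue_rVS n (h : 'rV[R]_n.+1 -> \bar R) :
  measurable_fun setT h -> (forall x, 0 <= h x)%E ->
  (\int[lebesgue_rV n.+1]_x h x =
   \int[leb]_t \int[lebesgue_rV n]_y h (rV_cons (t, y)))%E.
Proof.
move=> mh h0.
pose nu := pushforward_measure (leb \x lebesgue_rV n)%E (@measurable_rV_cons R n).
transitivity (\int[nu]_x h x)%E; first exact: eq_measure_integral.
rewrite ge0_integral_pushforward//; last exact: measurable_rV_cons.
rewrite (fubini_tonelli1 (h \o @rV_cons R n))//; last by move=> x; exact: h0.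
by apply: measurableT_comp => //; exact: measurable_rV_cons.
Qed.

Lemma measurable_rVB d (T : measurableType d) n (f g : T -> 'rV[R]_n) :
  measurable_fun setT f -> measurable_fun setT g ->
  measurable_fun setT (fun x => f x - g x).
Proof.
move=> mf mg; apply: measurable_fun_rVP => i.
rewrite (_ : _ \o _ = fun x => (rV_coord i \o f) x - (rV_coord i \o g) x); last first.
  by apply/funext => x; rewrite /rV_coord/= !mxE.
apply: measurable_funB.
  exact: (measurableT_comp (measurable_rV_coord i) mf).
exact: (measurableT_comp (measurable_rV_coord i) mg).
Qed.

Lemma ge0_integral_rV_reflect n (x : 'rV[R]_n) (h : 'rV[R]_n -> \bar R) :
  measurable_fun setT h -> (forall y, 0 <= h y)%E ->
  (\int[lebesgue_rV n]_y h (x - y)%R = \int[lebesgue_rV n]_y h y)%E.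
Proof.
elim: n x h => [|n IH] x h mh h0.
  by apply: eq_integral => y _; congr h; apply/rowP => -[].
have mhx : measurable_fun setT (fun y : 'rV[R]_n.+1 => h (x - y)).
  by apply: (measurableT_comp mh); exact: measurable_rVB.
rewrite [LHS](ge0_integral_lebesgue_rVS _ _ mhx (fun=> h0 _)).
rewrite [RHS](ge0_integral_lebesgue_rVS _ _ mh h0).
pose x' : 'rV[R]_n := \row_j x ord0 (lift ord0 j).
have consB t y : x - rV_cons (t, y) = rV_cons (x ord0 ord0 - t, x' - y).
  apply/rowP => i; rewrite !mxE; case: (unliftP ord0 i) => [j ->|->] /=.
    by rewrite !mxE.
  by [].
have mhc : measurable_fun setT (h \o @rV_cons R n).
  by apply: (measurableT_comp mh); exact: measurable_rV_cons.
transitivity (\int[leb]_t \int[lebesgue_rV n]_y h (rV_cons ((x ord0 ord0 - t)%R, y)))%E.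
  apply: eq_integral => t _.
  under eq_integral do rewrite consB.
  rewrite (IH x' (fun y => h (rV_cons (x ord0 ord0 - t, y))))//.
  exact: (measurableT_comp mhc (pair1_measurable _)).
rewrite -[RHS](ge0_integral_affine (-1) (x ord0 ord0)) ?oppr_eq0//; first last.
- by move=> t; exact: integral_ge0.
- apply: (@measurable_fun_fubini_tonelli_F _ _ _ _ _ (lebesgue_rV n) (h \o @rV_cons R n)) => //.
  by move=> p; exact: h0.
by rewrite normrN1 mul1e; under [RHS]eq_integral do rewrite mulN1r addrC.
Qed.

End lebesgue_rV_theory.

Section dilation_convolution.
Context {R : realType} {n : nat}.
Local Notation T := (measurableTypeR R * 'rV[R]_n)%type.
Local Notation leb := (@lebesgue_measure R).
Local Notation mu := (leb \x @lebesgue_rV R n)%E.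

(* The extra factor [E^-1] is the density of the Haar measure of R_+. *)
Definition haar_character (k : nat) (l : 'I_n -> R) (p : T) : R :=
  (0 < p.1)%R%:R * character k.+1 l p.

Lemma haar_character_ge0 k l p : 0 <= haar_character k l p.
Proof.
rewrite /haar_character; have [p0|_] := ltP 0 p.1; last by rewrite mul0r.
by rewrite mul1r mulr_ge0 ?expR_ge0// exprn_ge0// invr_ge0 ltW.
Qed.

Lemma measurable_haar_character k l : measurable_fun [set: T] (haar_character k l).
Proof.
apply: measurable_funM; last exact: measurable_character.
rewrite (_ : (fun _ => _) = \1_[set p : T | 0 < p.1]); last first.
  by apply/funext => p; rewrite indicE; congr (nat_of_bool _)%:R; apply/idP/idP; rewrite inE.
apply: measurable_indic.
have := @measurable_fst_prodR R n measurableT _ (measurable_itv `]0, +oo[).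
by rewrite setTI; congr measurable; apply/seteqP; split=> p /=; rewrite in_itv/= andbT.
Qed.

Lemma haar_character_translate k l (c E : R) (x y : 'rV[R]_n) : 0 < c ->
  haar_character k l (E, x - y) =
  c ^+ k.+1 * expR (- \sum_(i < n) l i * y ord0 i) * haar_character k l (c * E, x).
Proof.
move=> c0; rewrite /haar_character/= pmulr_rgt0//.
have [E0|_] := ltP 0 E; last by rewrite !mul0r mulr0.
rewrite !mul1r /character/= invfM exprMn.
have -> : \sum_(i < n) l i * (x - y) ord0 i =
    \sum_(i < n) l i * x ord0 i - \sum_(i < n) l i * y ord0 i.
  by rewrite -sumrB; apply: eq_bigr => i _; rewrite !mxE mulrBr.
have cc : c ^+ k.+1 * c^-1 ^+ k.+1 = 1 by rewrite -exprMn mulfV ?gt_eqF// expr1n.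
rewrite expRD -[LHS]mul1r -cc; ring.
Qed.

Variables (q kappa : 'rV[R]_n -> R).
Hypothesis mq : measurable_fun setT q.
Hypothesis mkappa : measurable_fun setT kappa.
Hypothesis kappa0 : forall y, 0 <= kappa y.
Hypothesis q_ge0 : forall y, 0 <= q y.
Hypothesis q_gt0 : {ae lebesgue_rV n, forall y, 0 < q y}.

Definition dilation_conv (h : T -> \bar R) (p : T) : \bar R :=
  (\int[lebesgue_rV n]_x ((kappa (x - p.2)%R)%:E * h ((p.1 * q (x - p.2))%R, x)))%E.

Lemma measurable_dilation_conv_integrand (h : T -> \bar R) :
  measurable_fun setT h ->
  measurable_fun [set: T * 'rV[R]_n] (fun z : T * 'rV[R]_n =>
    (kappa (z.2 - z.1.2)%R)%:E * h ((z.1.1 * q (z.2 - z.1.2))%R, z.2))%E.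
Proof.
move=> mh.
have mB : measurable_fun [set: T * 'rV[R]_n] (fun z : T * 'rV[R]_n => z.2 - z.1.2).
  apply: measurable_rVB => //.
  by apply: (measurableT_comp measurable_snd); exact: measurable_fst.
apply: emeasurable_funM; first by apply/measurable_EFinP; exact: measurableT_comp mkappa mB.
apply: (measurableT_comp mh); apply: measurable_fun_pair => //.
apply: (@measurable_funM _ _ R); last exact: measurableT_comp mq mB.
by apply: (measurableT_comp measurable_fst); exact: measurable_fst.
Qed.

Lemma dilation_conv_ge0 (h : T -> \bar R) p :
  (forall p, 0 <= h p)%E -> (0 <= dilation_conv h p)%E.
Proof. by move=> h0; apply: integral_ge0 => x _; rewrite mule_ge0// lee_fin. Qed.

Lemma measurable_dilation_conv (h : T -> \bar R) :
  measurable_fun setT h -> (forall p, 0 <= h p)%E ->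
  measurable_fun setT (dilation_conv h).
Proof.
move=> mh h0; have mc := measurable_dilation_conv_integrand h mh.
apply: (@measurable_fun_fubini_tonelli_F _ _ _ _ _ (lebesgue_rV n) _ mc).
by move=> z; rewrite mule_ge0// lee_fin.
Qed.

Lemma ge0_integral_dilation (c : R) (Phi : T -> \bar R) : 0 < c ->
  measurable_fun setT Phi -> (forall p, 0 <= Phi p)%E ->
  (c%:E * \int[mu]_p Phi ((c * p.1)%R, p.2) = \int[mu]_p Phi p)%E.
Proof.
move=> c0 mPhi Phi0.
have mPhic : measurable_fun setT (fun p : T => Phi (c * p.1, p.2)).
  apply: (measurableT_comp mPhi); apply: measurable_fun_pair => //.
  apply: (measurableT_comp (mulrl_measurable c)); exact: measurable_fst.
rewrite (fubini_tonelli2 Phi)// (fubini_tonelli2 (fun p : T => Phi ((c * p.1)%R, p.2)))//.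
rewrite -ge0_integralZl//; last 3 first.
- exact: (@measurable_fun_fubini_tonelli_G _ _ _ _ _ leb (fun p : T => Phi ((c * p.1)%R, p.2))).
- by move=> x _; exact: integral_ge0.
- by rewrite lee_fin ltW.
apply: eq_integral => x _ /=.
rewrite -[RHS](ge0_integral_affine c 0) ?gt_eqF//; last first.
  exact: (measurableT_comp mPhi (pair2_measurable x)).
by rewrite gtr0_norm//; under [in RHS]eq_integral do rewrite addr0.
Qed.

(* The Haar measure [dE / E * ds] of R_+ x R^n turns [dilation_conv] into a
   convolution, which characters diagonalize. *)
Lemma integral_haar_character_conv k l (h : T -> \bar R) :
  measurable_fun setT h -> (forall p, 0 <= h p)%E ->
  (\int[mu]_p ((haar_character k l p)%:E * dilation_conv h p) =
   (\int[lebesgue_rV n]_y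
      (kappa y * (q y ^+ k * expR (- \sum_(i < n) l i * y ord0 i)))%:E) *
   \int[mu]_p ((haar_character k l p)%:E * h p))%E.
Proof.
move=> mh h0; pose theta := haar_character k l.
have theta0 p : (0 <= (theta p)%:E)%E by rewrite lee_fin haar_character_ge0.
have mtheta : measurable_fun setT theta by exact: measurable_haar_character.
pose Phi p := ((theta p)%:E * h p)%E.
have mPhi : measurable_fun setT Phi.
  by apply: emeasurable_funM => //; exact/measurable_EFinP.
have Phi0 p : (0 <= Phi p)%E by rewrite mule_ge0.
pose dual y := q y ^+ k * expR (- \sum_(i < n) l i * y ord0 i).
have dual0 y : 0 <= dual y by rewrite mulr_ge0 ?exprn_ge0 ?expR_ge0.
have mdual : measurable_fun setT dual.
  apply: measurable_funM; first exact: measurable_funX.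
  apply: measurableT_comp => //; apply: measurable_funN; apply: measurable_sum => i.
  by apply: measurable_funM => //; exact: measurable_rV_coord.
pose G (z : T * 'rV[R]_n) := ((theta z.1)%:E *
  ((kappa (z.2 - z.1.2)%R)%:E * h ((z.1.1 * q (z.2 - z.1.2))%R, z.2)))%E.
have mconv := measurable_dilation_conv_integrand h mh.
have mG : measurable_fun setT G.
  apply: emeasurable_funM => //; apply/measurable_EFinP.
  exact: measurableT_comp mtheta measurable_fst.
have G0 z : (0 <= G z)%E by rewrite !mule_ge0// lee_fin.
pose K (z : T * 'rV[R]_n) := G ((z.1.1, z.1.2 - z.2), z.1.2).
have mK : measurable_fun setT K.
  apply: (measurableT_comp mG); apply: measurable_fun_pair => /=.
    apply: measurable_fun_pair => /=.
      by apply: (measurableT_comp measurable_fst); exact: measurable_fst.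
    apply: measurable_rVB => //.
    by apply: (measurableT_comp measurable_snd); exact: measurable_fst.
  by apply: (measurableT_comp measurable_snd); exact: measurable_fst.
have K0 z : (0 <= K z)%E by exact: G0.
have KE E x y : 0 < q y ->
    K ((E, x), y) = ((q y)%:E * (kappa y * dual y)%:E * Phi ((q y * E)%R, x))%E.
  move=> qy; rewrite /K /G/= subKr /theta (haar_character_translate _ _ _ _ _ _ qy).
  rewrite /Phi [E * _]mulrC !muleA -!EFinM /dual /theta; congr (_%:E * _)%E.
  by rewrite exprS; ring.
transitivity (\int[mu]_p \int[lebesgue_rV n]_x G (p, x))%E.
  apply: eq_integral => p _; rewrite /G/= ge0_integralZl//.
    exact: (measurableT_comp mconv (pair1_measurable p)).
  by move=> x _; rewrite mule_ge0// lee_fin.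
rewrite (fubini_tonelli1 (fun p => \int[lebesgue_rV n]_x G (p, x))%E)//; last 2 first.
- exact: (@measurable_fun_fubini_tonelli_F _ _ _ _ _ (lebesgue_rV n) G).
- by move=> p; exact: integral_ge0.
transitivity (\int[leb]_E \int[lebesgue_rV n]_y \int[lebesgue_rV n]_x K ((E, x), y))%E.
  apply: eq_integral => E _ /=.
  have mGE : measurable_fun setT (fun z : 'rV[R]_n * 'rV[R]_n => G ((E, z.1), z.2)).
    apply: (measurableT_comp mG); apply: measurable_fun_pair => //.
    exact: measurable_fun_pair.
  have mKE : measurable_fun setT (fun z : 'rV[R]_n * 'rV[R]_n => K ((E, z.1), z.2)).
    apply: (measurableT_comp mK); apply: measurable_fun_pair => //.
    exact: measurable_fun_pair.
  apply: (etrans (fubini_tonelli _ mGE _)); first by move=> z; exact: G0.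
  apply: etrans (fubini_tonelli _ mKE _); last by move=> z; exact: K0.
  apply: eq_integral => x _ /=.
  rewrite -(ge0_integral_rV_reflect _ x (fun s => G ((E, s), x)))//.
  exact: (measurableT_comp mGE (pair2_measurable x)).
have mKx : measurable_fun setT (fun z : measurableTypeR R * 'rV[R]_n =>
   \int[lebesgue_rV n]_x K ((z.1, x), z.2))%E.
  pose L (z : T * 'rV[R]_n) := K ((z.1.1, z.2), z.1.2).
  have mL : measurable_fun setT L.
    apply: (measurableT_comp mK); apply: measurable_fun_pair => /=.
      apply: measurable_fun_pair => //=.
      by apply: (measurableT_comp measurable_fst); exact: measurable_fst.
    by apply: (measurableT_comp measurable_snd); exact: measurable_fst.
  have L0 z : (0 <= L z)%E by exact: K0.
  exact: (@measurable_fun_fubini_tonelli_F _ _ _ _ _ (lebesgue_rV n) L mL L0).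
have KX0 (z : measurableTypeR R * 'rV[R]_n) :
    (0 <= \int[lebesgue_rV n]_x K ((z.1, x), z.2))%E by exact: integral_ge0.
apply: (etrans (fubini_tonelli _ mKx KX0)).
have mkd : measurable_fun setT (fun y => (kappa y * dual y)%:E).
  by apply/measurable_EFinP; exact: measurable_funM.
have kd0 y : (0 <= (kappa y * dual y)%:E)%E by rewrite lee_fin mulr_ge0.
transitivity (\int[lebesgue_rV n]_y ((kappa y * dual y)%:E * \int[mu]_p Phi p))%E;
  last by rewrite ge0_integralZr//; exact: integral_ge0.
apply: ge0_ae_eq_integral.
- exact: measurableT.
- exact: (@measurable_fun_fubini_tonelli_G _ _ _ _ _ leb _ mKx KX0).
- by apply: emeasurable_funM.
- by move=> y _; apply: integral_ge0 => E _; exact: integral_ge0.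
- by move=> y _; rewrite mule_ge0 ?integral_ge0.
apply: filterS q_gt0 => y qy _ /=.
have mPhiq : measurable_fun setT (fun p : T => Phi ((q y * p.1)%R, p.2)).
  apply: (measurableT_comp mPhi); apply: measurable_fun_pair => //.
  apply: (measurableT_comp (mulrl_measurable (q y))); exact: measurable_fst.
rewrite -(ge0_integral_dilation (q y))// muleA -EFinM [kappa y * dual y * q y]mulrC EFinM.
rewrite -ge0_integralZl//; last by rewrite mule_ge0// lee_fin.
pose Psi (p : T) := ((q y)%:E * (kappa y * dual y)%:E * Phi ((q y * p.1)%R, p.2))%E.
have mPsi : measurable_fun setT Psi by apply: emeasurable_funM.
have Psi0 p : (0 <= Psi p)%E by rewrite !mule_ge0// lee_fin.
apply/esym; apply: (etrans (fubini_tonelli1 Psi mPsi Psi0)).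
by apply: eq_integral => E _; apply: eq_integral => x _; rewrite KE.
Qed.

End dilation_convolution.

Section euclidean_norm.
Context {R : realType} {n : nat}.
Implicit Types y : 'rV[R]_n.

Lemma measurable_enorm : measurable_fun [set: 'rV[R]_n] (@enorm R n).
Proof.
apply: measurableT_comp.
  by apply: continuous_measurable_fun; exact: sqrt_continuous.
apply: measurable_sum => i; apply: measurable_funX; exact: measurable_rV_coord.
Qed.

Lemma enorm_ge0 y : 0 <= enorm y.
Proof. exact: sqrtr_ge0. Qed.

Lemma enorm_gt0 y : (0 < enorm y) = (y != 0).
Proof.
rewrite sqrtr_gt0 lt_neqAle sumr_ge0 ?andbT; last by move=> i _; exact: sqr_ge0.
rewrite eq_sym psumr_eq0; last by move=> i _; exact: sqr_ge0.
congr negb; apply/allP/eqP => [y0|-> i _]; last by rewrite mxE expr0n/= eqxx.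
apply/rowP => i; rewrite mxE; apply/eqP; rewrite -sqrf_eq0.
exact: y0 i (mem_index_enum i).
Qed.

Lemma coord_le_enorm y i : `|y ord0 i| <= enorm y.
Proof.
rewrite -sqrtr_sqr /enorm ler_wsqrtr// (bigD1 i)//= lerDl.
by apply: sumr_ge0 => j _; exact: sqr_ge0.
Qed.

Lemma enorm_le_coord (r : R) y : 0 <= r -> (forall i, `|y ord0 i| <= r) ->
  enorm y <= n%:R * r.
Proof.
move=> r0 yr; rewrite -(ger0_norm (mulr_ge0 (ler0n R n) r0)) -sqrtr_sqr ler_wsqrtr//.
apply: (@le_trans _ _ (n%:R * r ^+ 2)).
  rewrite mulr_natl -[n in leRHS]card_ord -sumr_const; apply: ler_sum => i _.
  by rewrite -real_normK ?num_real// lerXn2r ?nnegrE.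
rewrite exprMn ler_wpM2r ?sqr_ge0// -natrX ler_nat.
by case: n => // m; rewrite -mulnn leq_pmulr.
Qed.

End euclidean_norm.

Section lebesgue_rV_sets.
Context {R : realType} {n : nat}.

Lemma measurable_rV_box (A : 'I_n -> set (measurableTypeR R)) :
  (forall i, measurable (A i)) -> measurable [set y : 'rV[R]_n | forall i, A i (y ord0 i)].
Proof.
move=> mA; rewrite (_ : [set _ | _] =
    \bigcap_(i in [set: 'I_n]) (rV_coord i @^-1` A i)).
  apply: fin_bigcap_measurable => // i _.
  by rewrite -[X in measurable X]setTI; exact: measurable_rV_coord.
by apply/seteqP; split=> y yA i => [_|]; exact: yA.
Qed.

Lemma lebesgue_rV_cube (I : interval R) (r : R) :
  lebesgue_measure ([set` I] : set (measurableTypeR R)) = r%:E ->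
  lebesgue_rV n [set y : 'rV[R]_n | forall i, y ord0 i \in I] = (r ^+ n)%:E.
Proof.
move=> Ir; rewrite (@lebesgue_rV_box R n (fun=> [set` I])); last first.
  by move=> i; exact: measurable_itv.
rewrite (eq_bigr (fun=> r%:E)) => [|i _]; last exact: Ir.
elim: n => [|m IH]; first by rewrite big_ord0 expr0.
by rewrite big_ord_recl IH exprS EFinM.
Qed.

Lemma ae_rV_neq0 : (0 < n)%N -> {ae lebesgue_rV n, forall y : 'rV[R]_n, y != 0}.
Proof.
move=> n0; exists [set y : 'rV[R]_n | forall i, [set 0 : R] (y ord0 i)]; split.
- by apply: (measurable_rV_box (fun=> [set 0])).
- rewrite (@lebesgue_rV_box R n (fun=> [set 0]))//.
  by rewrite (bigD1 (Ordinal n0))//= lebesgue_measure_set1 mul0e.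
- by move=> y /= /negP; rewrite negbK => /eqP -> i; rewrite mxE.
Qed.

Lemma ge0_integral_gt0_lty (w M : R) (g : 'rV[R]_n -> R) : (0 < n)%N -> 0 < w ->
  measurable_fun setT g -> (forall y, 0 <= g y <= M) ->
  (forall y, w < enorm y -> g y = 0) ->
  (forall y, 0 < enorm y <= w -> 0 < g y) ->
  (0 < \int[lebesgue_rV n]_y (g y)%:E < +oo)%E.
Proof.
move=> n0 w0 mg gM g0 gp.
have gge0 y : 0 <= g y by have /andP[] := gM y.
have mgE : measurable_fun setT (EFin \o g) by exact/measurable_EFinP.
apply/andP; split.
- rewrite lt_neqAle integral_ge0 ?andbT//; last by move=> y _; rewrite lee_fin.
  apply/eqP => /esym ig0.
  pose r := w / n%:R.
  have r0 : 0 < r by rewrite divr_gt0// ltr0n.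
  pose B := [set y : 'rV[R]_n | forall i, y ord0 i \in `]0, r] ].
  have mB : measurable B by exact: (measurable_rV_box (fun=> `]0, r]%classic)).
  have : ae_eq (lebesgue_rV n) setT (EFin \o g) (cst 0%E).
    apply/ae_eq_integral_abs => //; rewrite -[RHS]ig0.
    by apply: eq_integral => y _; rewrite /= ger0_norm.
  move=> [N [mN N0 sN]].
  have BN : B `<=` N.
    move=> y By; apply: sN => /= /(_ I)[/eqP]; apply/negP; rewrite gt_eqF//; apply: gp.
    have B0 := By (Ordinal n0); rewrite in_itv/= in B0; case/andP: B0 => B0 _.
    apply/andP; split.
      by apply: lt_le_trans (coord_le_enorm _ (Ordinal n0)); rewrite normr_gt0 gt_eqF.
    rewrite -[leRHS](@divfK _ n%:R) ?pnatr_eq0 -?lt0n// mulrC.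
    apply: enorm_le_coord; first exact: ltW.
    by move=> i; have := By i; rewrite in_itv/= => /andP[yi0 yir]; rewrite gtr0_norm.
  have : (lebesgue_rV n B <= 0)%E by rewrite -N0; apply: le_measure => //; rewrite inE.
  rewrite (@lebesgue_rV_cube _ r); last first.
    by rewrite lebesgue_measure_itv/= lte_fin r0 sube0.
  by rewrite lee_fin leNgt exprn_gt0.
- pose B := [set y : 'rV[R]_n | forall i, y ord0 i \in `[-w, w] ].
  have mB : measurable B by exact: (measurable_rV_box (fun=> `[-w, w]%classic)).
  apply: (@le_lt_trans _ _ (\int[lebesgue_rV n]_(y in B) (cst M%:E) y)%E); last first.
    have BE : lebesgue_rV n B = ((w - - w) ^+ n)%:E.
      apply: lebesgue_rV_cube.
      by rewrite lebesgue_measure_itv/= lte_fin ifT// gt0_cp.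
    by rewrite integral_cst// [X in (_ * X)%E]BE -EFinM ltry.
  have -> : (\int[lebesgue_rV n]_y (g y)%:E =
      \int[lebesgue_rV n]_(y in B) (g y)%:E)%E.
    rewrite [RHS]integral_mkcond; apply: eq_integral => y _; rewrite patchE.
    case: ifPn => // /negP yB; congr EFin; apply: g0; rewrite ltNge; apply/negP => yw.
    apply: yB; rewrite inE => i; rewrite in_itv/= -ler_norml.
    exact: le_trans (coord_le_enorm _ i) yw.
  apply: ge0_le_integral => //.
  - by move=> y _; rewrite lee_fin.
  - exact: measurable_funTS.
  - by move=> y _; rewrite lee_fin; have /andP[] := gM y.
Qed.

End lebesgue_rV_sets.

Section moments.
Context {R : realType} {n : nat}.
Local Notation T := (measurableTypeR R * 'rV[R]_n)%type.
Local Notation mu := (lebesgue_measure \x @lebesgue_rV R n)%E.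

Lemma compact_sub_cylinder (a b : R) (K : set (R * 'rV[R]_n)) : compact K ->
  K `<=` [set t : R | a <= t <= b] `*` setT ->
  exists2 M, 0 <= M & K `<=` cylinder a b M.
Proof.
move=> cK Kab; have [M [_ KM]] := compact_bounded cK.
exists (`|M| + 1) => [|p Kp]; first by rewrite addr_ge0.
have [pab _] := Kab _ Kp; split=> // i.
have pM : `|p| <= `|M| + 1 by apply: KM => //; rewrite ltr_pwDr// ler_norm.
apply: le_trans pM; apply: (@le_trans _ _ `|p.2|).
  rewrite /Num.norm/= mx_normrE; apply: le_trans (le_bigmax _ _ (ord0, i)); exact: lexx.
by rewrite prod_normE le_max lexx orbT.
Qed.

Lemma lebesgue_cylinder_lty (a b M : R) : (mu (cylinder a b M) < +oo)%E.
Proof.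
have -> : cylinder a b M =
    `[a, b]%classic `*` [set y : 'rV[R]_n | forall i, y ord0 i \in `[-M, M] ].
  apply/seteqP; split=> -[t y] [/= tab yM]; split; rewrite /= ?in_itv//=.
    by move=> i; rewrite in_itv/= -ler_norml; exact: yM.
  by move=> i; rewrite ler_norml; have := yM i; rewrite in_itv.
have leb_itv (x y : R) : exists r,
    lebesgue_measure (`[x, y]%classic : set (measurableTypeR R)) = r%:E.
  by rewrite lebesgue_measure_itv; case: ifPn => _; eexists; [rewrite /= -EFinD|].
have [[r Ir] [r' Ir']] := (leb_itv (- M) M, leb_itv a b).
have mB : measurable [set y : 'rV[R]_n | forall i, y ord0 i \in `[-M, M] ].
  exact: (measurable_rV_box (fun=> `[-M, M]%classic)).
rewrite [ltLHS]product_measure1E// [X in (_ * X)%E](lebesgue_rV_cube _ _ Ir).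
by rewrite [X in (X * _)%E]Ir' -EFinM ltry.
Qed.

Lemma integrable_Lfun2_cylinder (a b M : R) (f : T -> R) : f \in Lfun mu 2%:E ->
  mu.-integrable (cylinder a b M) (EFin \o f).
Proof.
move=> fL2; have mf : measurable_fun setT f.
  by move: fL2; rewrite inE => /andP[]; rewrite inE.
have mD := @measurable_cylinder R n a b M.
have i2 : mu.-integrable (cylinder a b M) (EFin \o (fun x => f x ^+ 2)).
  by apply: integrableS (Lfun2_integrable_sqr fL2).
have i1 : mu.-integrable (cylinder a b M) (EFin \o cst 1).
  apply: measurable_bounded_integrable => //; first exact: lebesgue_cylinder_lty.
  by exists 1; split=> // x x1 p _; rewrite /= normr1 ltW.
apply: (le_integrable mD) (integrableD mD i1 i2).
  by apply/measurable_EFinP; exact: measurable_funTS.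
move=> p _ /=; rewrite lee_fin [leRHS]ger0_norm; last by rewrite addr_ge0 ?sqr_ge0.
rewrite -(real_normK (num_real (f p))).
have := sqr_ge0 (`|f p| - 2^-1); rewrite sqrrB; lra.
Qed.

Lemma integrable_haar_character k l (a b M : R) (f : T -> R) : 0 < a -> 0 <= M ->
  f \in Lfun mu 2%:E ->
  {ae mu, forall p, ~ cylinder a b M p -> f p = 0} ->
  mu.-integrable setT (fun p => (haar_character k l p * f p)%:E).
Proof.
move=> a0 M0 fL2 f0.
have mf : measurable_fun setT f.
  by move: fL2; rewrite inE => /andP[]; rewrite inE.
have mD := @measurable_cylinder R n a b M.
have mtf : measurable_fun setT (fun p => haar_character k l p * f p).
  by apply: measurable_funM => //; exact: measurable_haar_character.
have iD : mu.-integrable (cylinder a b M) (fun p => (haar_character k l p * f p)%:E).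
  have [C bC] : exists C, forall p, cylinder a b M p -> `|haar_character k l p| <= C.
    have [_ [C bC]] := character_bounded a b M k.+1 l a0 M0.
    exists C => p Dp; have [[/andP[ap _]] _] := Dp.
    by rewrite /haar_character (lt_le_trans a0 ap) mul1r bC.
  apply: (integrableMr mD _ _ (integrable_Lfun2_cylinder a b M f fL2)).
    by apply: measurable_funTS; exact: measurable_haar_character.
  exists C; split; first by rewrite num_real.
  by move=> y Cy x Dx; apply: le_trans (bC x Dx) (ltW Cy).
have /integrableP[_ iDlt] := iD.
apply/integrableP; split; first exact/measurable_EFinP.
apply: le_lt_trans iDlt; rewrite [leRHS]integral_mkcond le_eqVlt; apply/orP; left; apply/eqP.
have mabs : measurable_fun setT (fun p => `|(haar_character k l p * f p)%:E|)%E.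
  by apply: measurableT_comp => //; exact/measurable_EFinP.
apply: ge0_ae_eq_integral => //.
- by apply/(measurable_restrictT _ _).1 => //; exact: measurable_funTS.
- by move=> p _; rewrite patchE; case: ifPn.
apply: filterS f0 => p f0 _; rewrite patchE; case: ifPn => // /negP pD.
by rewrite f0 ?mulr0 ?abse0// => Dp; apply: pD; rewrite inE.
Qed.

End moments.

Section injectivity.
Context {R : realType} {n : nat}.
Local Notation T := (measurableTypeR R * 'rV[R]_n)%type.
Local Notation mu := (lebesgue_measure \x @lebesgue_rV R n)%E.
Variables (q kappa : 'rV[R]_n -> R).
Hypothesis mq : measurable_fun setT q.
Hypothesis mkappa : measurable_fun setT kappa.
Hypothesis kappa0 : forall y, 0 <= kappa y.
Hypothesis q_ge0 : forall y, 0 <= q y.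
Hypothesis q_gt0 : {ae lebesgue_rV n, forall y, 0 < q y}.
Hypothesis mass : forall k (l : 'I_n -> R), (0 < \int[lebesgue_rV n]_y
  (kappa y * (q y ^+ k * expR (- \sum_(i < n) l i * y ord0 i)))%:E < +oo)%E.

Let mconv h := @measurable_dilation_conv R n q kappa mq mkappa kappa0 h.
Let conv0 h p := @dilation_conv_ge0 R n q kappa kappa0 h p.

Lemma haar_character_conv_lty k l (h : T -> \bar R) :
  measurable_fun setT h -> (forall p, 0 <= h p)%E ->
  (\int[mu]_p ((haar_character k l p)%:E * h p) < +oo)%E ->
  {ae mu, forall p : T, 0 < p.1 -> (dilation_conv q kappa h p < +oo)%E}.
Proof.
move=> mh h0 hoo; pose theta := haar_character k l.
have i : mu.-integrable setT (fun p => (theta p)%:E * dilation_conv q kappa h p)%E.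
  apply/integrableP; split.
    apply: emeasurable_funM; last exact: mconv.
    by apply/measurable_EFinP; exact: measurable_haar_character.
  under eq_integral do rewrite gee0_abs ?mule_ge0 ?lee_fin ?haar_character_ge0 ?conv0//.
  rewrite integral_haar_character_conv//; have /andP[C0 Coo] := mass k l.
  have [->|H0] := eqVneq (\int[mu]_p ((haar_character k l p)%:E * h p))%E 0%E.
    by rewrite mule0.
  by apply: lte_mul_pinfty => //; [exact: ltW|rewrite ge0_fin_numE// ltW].
have := integrable_ae measurableT i; apply: filterS => p /(_ I) fp p0.
rewrite ltey; apply/eqP => Joo; move: fp; rewrite Joo.
have tp : 0 < theta p.
  by rewrite /theta /haar_character p0 mul1r mulr_gt0 ?expR_gt0// exprn_gt0// invr_gt0.
by rewrite gt0_muley ?lte_fin.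
Qed.

Lemma dilation_conv_injective (a b M : R) (f : T -> R) : 0 < a -> 0 <= M ->
  f \in Lfun mu 2%:E ->
  {ae mu, forall p : T, ~ cylinder a b M p -> f p = 0} ->
  {ae mu, forall p : T, 0 < p.1 ->
    (dilation_conv q kappa (EFin \o f)^\+ p < +oo)%E ->
    (dilation_conv q kappa (EFin \o f)^\- p < +oo)%E ->
    (dilation_conv q kappa (EFin \o f)^\+ p = dilation_conv q kappa (EFin \o f)^\- p)%E} ->
  {ae mu, forall p, f p = 0}.
Proof.
move=> a0 M0 fL2 f0 fconv.
have mf : measurable_fun setT f.
  by move: fL2; rewrite inE => /andP[]; rewrite inE.
have mfE : measurable_fun setT (EFin \o f) by exact/measurable_EFinP.
have mD := @measurable_cylinder R n a b M.
pose theta := @haar_character R n.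
have theta0 k l p : (0 <= (theta k l p)%:E)%E by rewrite lee_fin haar_character_ge0.
have ithf k l : mu.-integrable setT (fun p => (theta k l p * f p)%:E).
  exact: integrable_haar_character fL2 f0.
have posE k l p :
    ((theta k l p)%:E * (EFin \o f)^\+ p = (fun p => (theta k l p * f p)%:E)^\+ p)%E.
  by rewrite !funeposE maxe_pMr// mule0.
have negE k l p :
    ((theta k l p)%:E * (EFin \o f)^\- p = (fun p => (theta k l p * f p)%:E)^\- p)%E.
  by rewrite !funenegE maxe_pMr// mule0 muleN.
have poo k l : (\int[mu]_p ((theta k l p)%:E * (EFin \o f)^\+ p) < +oo)%E.
  under eq_integral do rewrite posE.
  exact: integral_funepos_lt_pinfty (ithf k l).
have noo k l : (\int[mu]_p ((theta k l p)%:E * (EFin \o f)^\- p) < +oo)%E.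
  under eq_integral do rewrite negE.
  exact: integral_funeneg_lt_pinfty (ithf k l).
have mp : measurable_fun setT (EFin \o f)^\+%E by exact: measurable_funepos.
have mn : measurable_fun setT (EFin \o f)^\-%E by exact: measurable_funeneg.
have p0 p : (0 <= (EFin \o f)^\+%E p)%E by exact: funepos_ge0.
have n0 p : (0 <= (EFin \o f)^\-%E p)%E by exact: funeneg_ge0.
have thf0 k l : (\int[mu]_p (theta k l p * f p)%:E = 0)%E.
  have : (\int[mu]_p ((theta k l p)%:E * dilation_conv q kappa (EFin \o f)^\+ p) =
      \int[mu]_p ((theta k l p)%:E * dilation_conv q kappa (EFin \o f)^\- p))%E.
    apply: ge0_ae_eq_integral => //.
    - apply: emeasurable_funM; last exact: mconv.
      by apply/measurable_EFinP; exact: measurable_haar_character.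
    - apply: emeasurable_funM; last exact: mconv.
      by apply/measurable_EFinP; exact: measurable_haar_character.
    - by move=> p _; rewrite mule_ge0// conv0.
    - by move=> p _; rewrite mule_ge0// conv0.
    move: fconv; apply: filterS3 (haar_character_conv_lty k l _ mp p0 (poo k l))
      (haar_character_conv_lty k l _ mn n0 (noo k l)) => p ep en e _.
    have [p1|p1] := ltP 0 p.1; first by rewrite e// ?ep ?en.
    by rewrite /theta /haar_character ltNge p1 mul0r !mul0e.
  rewrite !integral_haar_character_conv//; have /andP[C0 Coo] := mass k l.
  have -> : (\int[mu]_p (theta k l p * f p)%:E =
      \int[mu]_p ((theta k l p)%:E * (EFin \o f)^\+ p) -
      \int[mu]_p ((theta k l p)%:E * (EFin \o f)^\- p))%E.
    rewrite integralE; congr (_ - _)%E; apply: eq_integral => p _.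
      by rewrite -posE.
    by rewrite -negE.
  have := poo k l; have := noo k l.
  rewrite -!ge0_fin_numE; [|by apply: integral_ge0 => p _; rewrite mule_ge0..].
  rewrite -/(theta k l).
  move: C0 Coo; set C := (\int[lebesgue_rV n]_y _)%E.
  set P := (\int[mu]_p _)%E; set N := (\int[mu]_p _)%E.
  move: C P N => [c| |] [x| |] [y| |]//=; rewrite lte_fin => c0 _ _ _.
  by rewrite -!EFinM => -[] /(mulfI (lt0r_neq0 c0)) ->; rewrite subee.
pose F p := f p * p.1^-1.
have Fth k l p : cylinder a b M p -> F p * character k l p = theta k l p * f p.
  move=> [/andP[ap _] _]; rewrite /theta /haar_character (lt_le_trans a0 ap) mul1r.
  by rewrite /F /character exprS; ring.
have iF : mu.-integrable (cylinder a b M) (EFin \o F).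
  have := integrableS measurableT mD (@subsetT _ _) (ithf 0%N (fun=> 0)).
  apply: eq_integrable => // p; rewrite inE => Dp /=.
  rewrite -Fth// /character expr0 mul1r big1 ?expR0 ?mulr1// => i _.
  by rewrite mul0r.
have mom k l : (\int[mu]_(p in cylinder a b M) (F p * character k l p)%:E = 0)%E.
  rewrite -[RHS](thf0 k l).
  transitivity (\int[mu]_(p in cylinder a b M) (theta k l p * f p)%:E)%E.
    by apply: eq_integral => p; rewrite inE => Dp; rewrite Fth.
  rewrite integral_mkcond; apply: ae_eq_integral => //.
  - apply/(measurable_restrictT _ _).1 => //.
    by apply: measurable_funTS; exact: measurable_int (ithf k l).
  - exact: measurable_int (ithf k l).
  apply: filterS f0 => p f0 _; rewrite patchE; case: ifPn => // /negP pD.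
  by rewrite f0 ?mulr0// => Dp; apply: pD; rewrite inE.
have := character_moments_ae0 a b M F a0 M0 iF mom.
apply: filterS2 f0 => p f0 F0.
have [Dp|Dp] := pselect (cylinder a b M p); last exact: f0.
have [/andP[ap _] _] := Dp.
have /eqP := F0 Dp; rewrite mulf_eq0 invr_eq0 (gt_eqF (lt_le_trans a0 ap)) orbF.
by move/eqP.
Qed.

End injectivity.

Lemma continuous_nonvanishing_sg {R : realType} (f : R -> R) :
  continuous f -> (forall t, f t != 0) ->
  forall t, 0 <= t -> f t = Num.sg (f 0) * `|f t|.
Proof.
move=> cf f0 t t0; rewrite [LHS]numEsg; congr (_ * _).
have IVT0 : Num.min (f 0) (f t) <= 0 <= Num.max (f 0) (f t) -> False.
  move=> /(IVT t0 (continuous_subspaceT cf))[c _ /eqP].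
  by rewrite (negbTE (f0 c)).
have := f0 0; have := f0 t; rewrite !neq_lt => /orP[ft|ft] /orP[fo|fo].
- by rewrite !ltr0_sg.
- by exfalso; apply: IVT0; rewrite ge_min le_max (ltW ft) (ltW fo) ?orbT.
- by exfalso; apply: IVT0; rewrite ge_min le_max (ltW ft) (ltW fo) ?orbT.
- by rewrite !gtr0_sg.
Qed.

Section bragg_dilation_conv.
Context {R : realType} {n : nat}.
Local Notation T := (measurableTypeR R * 'rV[R]_n)%type.
Variables (w : R) (q1 : R -> R) (W : R -> R -> R) (W1 W2 : R -> R).
Hypothesis hW : forall E t : R, 0 < E -> W E t = W1 E * W2 t.
Hypothesis W1_neq0 : forall E : R, 0 < E -> W1 E != 0.
Hypothesis W2_neq0 : forall t : R, W2 t != 0.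
Hypothesis cW2 : continuous W2.
Hypothesis mq1 : measurable_fun setT (fun y : 'rV[R]_n => q1 (enorm y)).

Definition bragg_weight (y : 'rV[R]_n) : R := `|W2 (enorm y)| * (enorm y <= w)%R%:R.

Lemma bragg_weight_ge0 y : 0 <= bragg_weight y.
Proof. exact: mulr_ge0. Qed.

Lemma measurable_bragg_weight : measurable_fun setT bragg_weight.
Proof.
apply: measurable_funM.
  apply: measurableT_comp => //; apply: measurableT_comp; last exact: measurable_enorm.
  exact: continuous_measurable_fun.
rewrite (_ : (fun _ => _) = \1_[set y : 'rV[R]_n | enorm y <= w]); last first.
  by apply/funext => y; rewrite indicE; congr (nat_of_bool _)%:R; apply/idP/idP; rewrite inE.
apply: measurable_indic.
have := @measurable_enorm R n measurableT _ (measurable_itv `]-oo, w]).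
by rewrite setTI; congr measurable; apply/seteqP; split=> y /=; rewrite in_itv.
Qed.

Lemma bragg_eq0_dilation_conv (f : T -> R) (p : T) : measurable_fun setT f ->
  0 < p.1 -> bragg W q1 w f p.1 p.2 = 0 ->
  (dilation_conv (fun y => q1 (enorm y)) bragg_weight (EFin \o f)^\+ p < +oo)%E ->
  (dilation_conv (fun y => q1 (enorm y)) bragg_weight (EFin \o f)^\- p < +oo)%E ->
  (dilation_conv (fun y => q1 (enorm y)) bragg_weight (EFin \o f)^\+ p =
   dilation_conv (fun y => q1 (enorm y)) bragg_weight (EFin \o f)^\- p)%E.
Proof.
move: p => [E s] /= mf E0; rewrite /bragg.
pose g x := bragg_weight (x - s) * f (E * q1 (enorm (x - s)), x).
have mg : measurable_fun setT g.
  apply/measurable_EFinP.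
  have mfE : measurable_fun setT (EFin \o f) by exact/measurable_EFinP.
  have mc := measurable_dilation_conv_integrand _ _ mq1 measurable_bragg_weight _ mfE.
  exact: (measurableT_comp mc (pair1_measurable ((E, s) : T))).
have gE x : W E (enorm (x - s)) * \1_(closed_eball s w) x *
    f (E * q1 (enorm (x - s)), x) = W1 E * Num.sg (W2 0) * g x.
  rewrite hW// (continuous_nonvanishing_sg _ cW2 W2_neq0) ?enorm_ge0//.
  rewrite /g /bragg_weight indicE.
  have -> : (x \in closed_eball s w) = (enorm (x - s) <= w).
    by apply/idP/idP; rewrite inE.
  ring.
have J0 h : (forall p, 0 <= h p)%E ->
    (0 <= dilation_conv (fun y => q1 (enorm y)) bragg_weight h (E, s))%E.
  exact/dilation_conv_ge0/bragg_weight_ge0.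
have /J0 Jp0 : (forall p, 0 <= (EFin \o f)^\+ p)%E by exact: funepos_ge0.
have /J0 Jn0 : (forall p, 0 <= (EFin \o f)^\- p)%E by exact: funeneg_ge0.
have igE : (\int[lebesgue_rV n]_x (g x)%:E =
    dilation_conv (fun y => q1 (enorm y)) bragg_weight (EFin \o f)^\+ (E, s) -
    dilation_conv (fun y => q1 (enorm y)) bragg_weight (EFin \o f)^\- (E, s))%E.
  rewrite integralE; congr (_ - _)%E; apply: eq_integral => x _.
    by rewrite !funeposE maxe_pMr ?mule0// lee_fin bragg_weight_ge0.
  by rewrite !funenegE maxe_pMr ?mule0 ?muleN// lee_fin bragg_weight_ge0.
under eq_Rintegral do rewrite gE.
move=> b0; rewrite -!ge0_fin_numE// => Jpf Jnf.
have ig : (lebesgue_rV n).-integrable setT (EFin \o g).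
  apply/integrableP; split; first exact/measurable_EFinP.
  by rewrite integral_fin_num_abs// igE fin_numB Jpf.
move: b0; rewrite RintegralZl// => /eqP; rewrite mulf_eq0 mulf_eq0 sgr_eq0.
rewrite (negbTE (W1_neq0 _ E0)) (negbTE (W2_neq0 _))/= /Rintegral igE.
move: Jpf Jnf; case: (dilation_conv _ _ (EFin \o f)^\+%E _) => [x| |]//.
case: (dilation_conv _ _ (EFin \o f)^\-%E _) => [y| |]// _ _ /=.
by rewrite subr_eq0 => /eqP ->.
Qed.

Hypothesis w0 : 0 < w.
Hypothesis n0 : (0 < n)%N.
Hypothesis q10 : q1 0 = 0.
Hypothesis q1_incr : {in [pred t : R | 0 <= t] &, {homo q1 : x y / x < y}}.

Let q1_lt a b : 0 <= a -> a < b -> q1 a < q1 b.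
Proof. by move=> a0 ab; apply: q1_incr => //; rewrite inE// (le_trans a0)// ltW. Qed.

Lemma q1_enorm_ge0 (y : 'rV[R]_n) : 0 <= q1 (enorm y).
Proof.
have := enorm_ge0 y; rewrite le_eqVlt => /predU1P[<-|y0]; first by rewrite q10.
by rewrite -q10 ltW// q1_lt.
Qed.

Lemma q1_enorm_gt0 (y : 'rV[R]_n) : 0 < enorm y -> 0 < q1 (enorm y).
Proof. by move=> y0; rewrite -q10 q1_lt. Qed.

Hypothesis W2_bounded : exists M : R, forall t : R, - w <= t <= w -> `|W2 t| <= M.

Lemma bragg_mass k (l : 'I_n -> R) : (0 < \int[lebesgue_rV n]_y
  (bragg_weight y * (q1 (enorm y) ^+ k * expR (- \sum_(i < n) l i * y ord0 i)))%:E
    < +oo)%E.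
Proof.
have [M W2M] := W2_bounded.
have M0 : 0 <= M.
  by apply: le_trans (normr_ge0 (W2 0)) (W2M 0 _); rewrite oppr_le0 ltW.
have weight0 y : w < enorm y -> bragg_weight y = 0.
  by move=> yw; rewrite /bragg_weight leNgt yw mulr0.
apply: (ge0_integral_gt0_lty w
  (M * (q1 w ^+ k * expR (\sum_(i < n) `|l i| * w)))) => //.
- apply: measurable_funM; first exact: measurable_bragg_weight.
  apply: measurable_funM; first exact: measurable_funX.
  apply: measurableT_comp => //; apply: measurable_funN; apply: measurable_sum => i.
  by apply: measurable_funM => //; exact: measurable_rV_coord.
- move=> y; have q0 := exprn_ge0 k (q1_enorm_ge0 y).
  rewrite !mulr_ge0 ?expR_ge0//=; have [yw|yw] := leP (enorm y) w; last first.
    rewrite weight0// mul0r.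
    by rewrite !mulr_ge0 ?expR_ge0// exprn_ge0// -q10 ltW// q1_lt.
  apply: ler_pM; rewrite ?bragg_weight_ge0 ?mulr_ge0 ?expR_ge0//.
    rewrite /bragg_weight yw mulr1 W2M// yw andbT.
    by rewrite (le_trans _ (enorm_ge0 y))// oppr_le0 ltW.
  apply: ler_pM; rewrite ?expR_ge0//.
    apply: lerXn2r; rewrite ?nnegrE ?q1_enorm_ge0//.
      by rewrite -q10 ltW// q1_lt.
    move: yw; rewrite le_eqVlt => /predU1P[->//|yw].
    by rewrite ltW// q1_lt// enorm_ge0.
  rewrite ler_expR -sumrN; apply: ler_sum => i _.
  apply: (le_trans (ler_norm _)); rewrite normrN normrM ler_wpM2l//.
  exact: le_trans (coord_le_enorm _ _) yw.
- by move=> y /weight0 ->; rewrite mul0r.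
- move=> y /andP[y0 yw]; rewrite /bragg_weight yw mulr1 !mulr_gt0 ?expR_gt0 ?normr_gt0//.
  by rewrite exprn_gt0// q1_enorm_gt0.
Qed.

End bragg_dilation_conv.

Theorem theorem5p1 (R : realType) (Em EM : R) (hEm : 0 < Em) (hEM : Em < EM)
  (n : nat) (hn : (2 <= n)%N) (w : R) (hw : 0 < w)
  (q1 g : R -> R)
  (hq1C2 : Ck_on 2 [set t : R | 0 <= t] q1)
  (hq1incr : {in [pred t : R | 0 <= t] &, {homo q1 : x y / x < y}})
  (hg : {in [pred t : R | 0 <= t], cancel q1 g})
  (hq10 : q1 0 = 0)
  (c1 c2 : R) (hc1 : c1 = c2 * Em / EM) (hc2 : c2 = q1 w)
  (hq1' : forall t : R, g c1 <= t <= w -> 0 < derive1 q1 t)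
  (W : R -> R -> R) (W1 W2 : R -> R)
  (hW : forall E t : R, 0 < E -> W E t = W1 E * W2 t)
  (hW1C1 : Ck_on 1 [set E : R | 0 < E] W1)
  (hW2C1 : Ck_on 1 [set: R] W2)
  (hW1nz : forall E : R, 0 < E -> W1 E != 0)
  (hW2nz : forall t : R, W2 t != 0)
  (hW2bd : exists M : R, forall t : R, - w <= t <= w -> `|W2 t| <= M)
  (hW2'bd : exists M : R, forall t : R, - w <= t <= w -> `|derive1 W2 t| <= M) :
  forall f : measurableTypeR R * 'rV[R]_n -> R,
    L2_0 ([set q : R | Em <= q <= EM] `*` [set: 'rV[R]_n]) f ->
    {ae (lebesgue_measure \x lebesgue_rV n)%E, forall p : R * 'rV[R]_n,
      0 < p.1 -> bragg W q1 w f p.1 p.2 = 0} ->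
    {ae (lebesgue_measure \x lebesgue_rV n)%E, forall p : R * 'rV[R]_n,
      f p = 0}.
Proof.
move=> f [fL2 [K [cK KOmega] fK]] fB.
have n0 : (0 < n)%N by exact: leq_trans hn.
have mf : measurable_fun setT f.
  by move: fL2; rewrite inE => /andP[]; rewrite inE.
have cW2 : continuous W2 by apply/continuous_subspace_setT; case: hW2C1.
have mq1 : measurable_fun setT (fun y : 'rV[R]_n => q1 (enorm y)).
  have mD : measurable ([set t : R | 0 <= t] : set (measurableTypeR R)).
    by have := measurable_itv `[0 : R, +oo[; congr measurable;
      apply/seteqP; split=> t /=; rewrite in_itv/= andbT.
  apply: (measurable_comp mD); last exact: measurable_enorm.
    by move=> _ [y _ <-] /=; exact: enorm_ge0.
  by apply: subspace_continuous_measurable_fun => //; case: hq1C2.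
have [M M0 KM] := compact_sub_cylinder _ _ _ cK KOmega.
apply: (dilation_conv_injective (fun y => q1 (enorm y)) (bragg_weight w W2)
  mq1 _ _ _ _ _ _ _ _ f hEm M0 fL2).
- exact: measurable_bragg_weight.
- exact: bragg_weight_ge0.
- exact: q1_enorm_ge0.
- apply: filterS (ae_rV_neq0 n0) => y y0.
  by apply: q1_enorm_gt0 => //; rewrite enorm_gt0.
- exact: bragg_mass.
- have {}fK : {ae (lebesgue_measure \x lebesgue_rV n)%E,
      forall p : measurableTypeR R * 'rV[R]_n, ~ K p -> f p = 0}.
    exact: fK.
  by apply: filterS fK => p pK Dp; apply: pK => Kp; exact/Dp/KM.
- have {}fB : {ae (lebesgue_measure \x lebesgue_rV n)%E,
      forall p : measurableTypeR R * 'rV[R]_n, 0 < p.1 -> bragg W q1 w f p.1 p.2 = 0}.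
    exact: fB.
  apply: filterS fB => p pB p0.
  exact: (bragg_eq0_dilation_conv w q1 W W1 W2 hW hW1nz hW2nz cW2 mq1 f p mf p0 (pB p0)).
Qed.
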